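(* Let $K$ be a number field whose ring of integers $\mathcal{O}_K$ is a principal ideal domain. Let $\alpha \in \mathcal{O}_K$ be non-zero with prime ideal factorization $(\alpha) = \mathfrak{p}_1^{e_1} \cdots \mathfrak{p}_g^{e_g}$, with $\mathfrak{p}_1,\dots,\mathfrak{p}_g$ distinct, and let $$n(\alpha) = \frac{1}{h} \sum_{\chi \in \hat{G}} \prod_{i=1}^{g} \left( \sum_{k=0}^{e_i} \chi([\mathfrak{p}_i])^k \right)$$ where $G = Cl(K)$ and $h = |Cl(K)|$. Then this formula reduces to the standard count of divisors in a unique factorization domain: $$n(\alpha) = \prod_{i=1}^{g} (e_i + 1).$$
   Context: $Cl(K)$ is the ideal class group of $K$, $[\mathfrak{p}]$ denotes the class of the ideal $\mathfrak{p}$ in $Cl(K)$, and $\hat{G}$ is the group of all group homomorphisms $\chi : G \to \mathbb{C}^*$. The quantity $n(\alpha)$ denotes the number of principal ideal divisors of $(\alpha)$, i.e. the number of principal ideals of the form $\prod_{i=1}^g \mathfrak{p}_i^{f_i}$ with $0 \le f_i \le e_i$, which is given by the displayed character formula. *)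

(* Defs.v *)
From HB Require Import structures.
From mathcomp Require Import all_boot all_order all_algebra all_field.
From mathcomp Require Import generic_quotient.
From mathcomp Require Import boolp classical_sets functions cardinality.
From mathcomp Require Import fsbigop reals finmap.
From mathcomp Require Import complex.

Set Implicit Arguments.
Unset Strict Implicit.
Unset Printing Implicit Defensive.

Import GRing.Theory Num.Theory.

Local Open Scope ring_scope.
Local Open Scope quotient_scope.

(* Ideals are arbitrary, not necessarily decidable or proper, so that the
   idealr structure of ring_quotient is not suitable. *)
Section Ideals.
Variable R : comNzRingType.

Definition is_ideal (I : R -> Prop) : Prop :=
  [/\ I 0, forall x y, I x -> I y -> I (x + y) & forall a x, I x -> I (a * x)].

Record ideal := Ideal { ideal_set :> R -> Prop; idealP : is_ideal ideal_set }.

HB.instance Definition _ := gen_eqMixin ideal.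
HB.instance Definition _ := gen_choiceMixin ideal.

Lemma ideal_ext (I J : ideal) :
  (forall x, I x -> J x) -> (forall x, J x -> I x) -> I = J.
Proof.
case: I J => [I HI] [J HJ] /= IJ JI.
have E : I = J by apply/funext => x; apply/propext; split; [apply: IJ|apply: JI].
by case: J / E HJ {IJ JI} => HJ; rewrite (Prop_irrelevance HI HJ).
Qed.

Lemma ideal0 (I : ideal) : I 0. Proof. by case: (idealP I). Qed.
Lemma idealD (I : ideal) x y : I x -> I y -> I (x + y).
Proof. by case: (idealP I) => _ + _; apply. Qed.
Lemma idealMl (I : ideal) a x : I x -> I (a * x).
Proof. by case: (idealP I) => _ _; apply. Qed.

Fact principal_is_ideal (a : R) : is_ideal (fun x => exists b, x = b * a).
Proof.
split; first by exists 0; rewrite mul0r.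
- by move=> _ _ [b ->] [c ->]; exists (b + c); rewrite mulrDl.
- by move=> c _ [b ->]; exists (c * b); rewrite mulrA.
Qed.
Definition principal (a : R) : ideal := Ideal (principal_is_ideal a).

Fact ideal_mul_is_ideal (I J : ideal) :
  is_ideal (fun x => exists2 s : seq (R * R),
    (forall q, q \in s -> I q.1 /\ J q.2) & x = \sum_(q <- s) q.1 * q.2).
Proof.
split; first by exists [::] => //; rewrite big_nil.
- move=> _ _ [s Hs ->] [t Ht ->]; exists (s ++ t); last by rewrite big_cat.
  by move=> q; rewrite mem_cat => /orP[/Hs|/Ht].
- move=> a _ [s Hs ->]; exists [seq (a * q.1, q.2) | q <- s].
    by move=> _ /mapP[q /Hs[Iq Jq] ->]; split=> //; apply: idealMl.
  by rewrite big_map mulr_sumr; apply: eq_bigr => q _; rewrite mulrA.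
Qed.
Definition ideal_mul (I J : ideal) : ideal := Ideal (ideal_mul_is_ideal I J).

Lemma ideal_mul_in (I J : ideal) x y : I x -> J y -> ideal_mul I J (x * y).
Proof.
move=> Ix Jy; exists [:: (x, y)]; last by rewrite big_seq1.
by move=> q; rewrite inE => /eqP->.
Qed.

Lemma ideal_mul_sub (I J L : ideal) :
  (forall x y, I x -> J y -> L (x * y)) -> forall z, ideal_mul I J z -> L z.
Proof.
move=> H _ [s Hs ->]; rewrite big_seq.
apply: (big_ind (fun z => L z)); [exact: ideal0|exact: idealD|].
by move=> q /Hs[Iq Jq]; apply: H.
Qed.

Lemma ideal_mulC : commutative ideal_mul.
Proof.
by move=> I J; apply: ideal_ext; apply: ideal_mul_sub => x y Hx Hy;
  rewrite mulrC; apply: ideal_mul_in.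
Qed.

Lemma ideal_mulA_sub (I J L : ideal) z :
  ideal_mul I (ideal_mul J L) z -> ideal_mul (ideal_mul I J) L z.
Proof.
apply: ideal_mul_sub => x _ Ix [s Hs ->]; rewrite mulr_sumr big_seq.
apply: (big_ind (fun z => ideal_mul (ideal_mul I J) L z));
  [exact: ideal0|exact: idealD|].
by move=> q /Hs[Jq Lq]; rewrite mulrA; apply/ideal_mul_in/Lq/ideal_mul_in.
Qed.

Lemma ideal_mulA : associative ideal_mul.
Proof.
move=> I J L; apply: ideal_ext; first exact: ideal_mulA_sub.
move=> z; rewrite (ideal_mulC (ideal_mul I J)) (ideal_mulC I J).
by move/ideal_mulA_sub; rewrite (ideal_mulC L) (ideal_mulC _ I).
Qed.

Lemma ideal_mul1 : left_id (principal 1) ideal_mul.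
Proof.
move=> I; apply: ideal_ext => [|x Ix].
  by apply: ideal_mul_sub => _ y [b ->] Iy; apply: idealMl.
by rewrite -[x]mul1r; apply: ideal_mul_in => //; exists 1; rewrite mulr1.
Qed.

Lemma ideal_mul1r : right_id (principal 1) ideal_mul.
Proof. by move=> I; rewrite ideal_mulC ideal_mul1. Qed.

HB.instance Definition _ :=
  isMonoid.Build ideal ideal_mulA ideal_mul1 ideal_mul1r.

Lemma principalM a b : (principal a * principal b)%g = principal (a * b).
Proof.
apply: ideal_ext.
  by apply: ideal_mul_sub => _ _ [c ->] [d ->]; exists (c * d); rewrite mulrACA.
by move=> _ [c ->]; rewrite mulrA; apply: ideal_mul_in;
  [exists c|exists 1; rewrite mul1r].
Qed.

Definition prime_ideal (P : ideal) : Prop :=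
  ~ P 1 /\ forall x y, P (x * y) -> P x \/ P y.

Definition principal_ideal_ring : Prop :=
  forall I : ideal, exists a, I = principal a.

End Ideals.

(* The ideal class group of a domain R: invertible ideals I of R, modulo
   I ~ J iff aI = bJ for some nonzero a, b.  An ideal is invertible iff it
   divides a nonzero principal ideal; in a Dedekind domain, such as a ring of
   integers, every nonzero ideal is invertible, and the factors of a nonzero
   principal ideal are invertible by definition. *)
Section ClassGroup.
Variable R : idomainType.

Definition invertible (I : ideal R) : Prop :=
  exists (J : ideal R) (a : R), a != 0 /\ (I * J)%g = principal a.

Lemma dvd_principal_invertible (I J : ideal R) (a : R) :
  a != 0 -> (I * J)%g = principal a -> invertible I.
Proof. by move=> a0 E; exists J, a. Qed.

Record inv_ideal :=
  InvIdeal { inv_ideal_val :> ideal R; inv_idealP : invertible inv_ideal_val }.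

HB.instance Definition _ := gen_eqMixin inv_ideal.
HB.instance Definition _ := gen_choiceMixin inv_ideal.

Definition class_rel (I J : inv_ideal) : bool :=
  `[< exists a b : R, [/\ a != 0, b != 0 &
        (principal a * I)%g = (principal b * J)%g] >].

Fact class_rel_refl : reflexive class_rel.
Proof. by move=> I; apply/asboolP; exists 1, 1; rewrite oner_neq0. Qed.
Fact class_rel_sym : symmetric class_rel.
Proof.
by move=> I J; apply/asboolP/asboolP => -[a [b [a0 b0 E]]]; exists b, a.
Qed.
Fact class_rel_trans : transitive class_rel.
Proof.
move=> J I L /asboolP[a [b [a0 b0 E]]] /asboolP[c [d [c0 d0 F]]].
apply/asboolP; exists (c * a), (b * d); rewrite !mulf_neq0 //; split=> //.
by rewrite -!principalM -!mulgA E -F !mulgA !principalM mulrC.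
Qed.

Canonical class_equiv :=
  EquivRel class_rel class_rel_refl class_rel_sym class_rel_trans.

Definition class_group := {eq_quot class_equiv}.

HB.instance Definition _ := Choice.on class_group.

Definition ideal_class (I : inv_ideal) : class_group := \pi_class_group I.

Lemma ideal_classP (I J : inv_ideal) :
  ideal_class I = ideal_class J <->
  exists a b : R, [/\ a != 0, b != 0 &
    (principal a * I)%g = (principal b * J)%g].
Proof. by split=> [/eqmodP/asboolP|H]; last exact/eqmodP/asboolP. Qed.

Fact inv_ideal_one_subproof : invertible 1%g.
Proof. by exists 1%g, 1; rewrite oner_neq0 mulg1. Qed.
Definition inv_ideal_one := InvIdeal inv_ideal_one_subproof.

Fact inv_ideal_mul_subproof (I J : inv_ideal) : invertible (ideal_mul I J).
Proof.
case: I J => [I [I' [a [a0 E]]]] [J [J' [b [b0 F]]]] /=.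
exists (I' * J')%g, (a * b); rewrite mulf_neq0 //; split=> //.
rewrite -principalM -E -F -!mulgA; congr (_ * _)%g.
by rewrite !mulgA; congr (_ * _)%g; apply: ideal_mulC.
Qed.
Definition inv_ideal_mul I J := InvIdeal (inv_ideal_mul_subproof I J).

Fact cofactor_subproof (I : inv_ideal) : exists J : inv_ideal,
  exists2 a : R, a != 0 & ideal_mul I J = principal a.
Proof.
case: I => [I [J [a [a0 E]]]] /=.
have HJ : invertible J by exists I, a; split=> //; rewrite -E; apply: ideal_mulC.
by exists (InvIdeal HJ), a.
Qed.
Definition cofactor (I : inv_ideal) : inv_ideal := sval (cid (cofactor_subproof I)).

Definition class_mul (x y : class_group) : class_group :=
  ideal_class (inv_ideal_mul (repr x) (repr y)).
Definition class_one : class_group := ideal_class inv_ideal_one.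
Definition class_inv (x : class_group) : class_group :=
  ideal_class (cofactor (repr x)).

Lemma class_ind (P : class_group -> Prop) :
  (forall I, P (ideal_class I)) -> forall x, P x.
Proof. by move=> H x; rewrite -[x]reprK; apply: H. Qed.

Lemma class_mulE I J :
  class_mul (ideal_class I) (ideal_class J) = ideal_class (inv_ideal_mul I J).
Proof.
apply/ideal_classP.
have /ideal_classP[a [b [a0 b0 E]]] : ideal_class (repr (ideal_class I)) = ideal_class I.
  exact: reprK.
have /ideal_classP[c [d [c0 d0 F]]] : ideal_class (repr (ideal_class J)) = ideal_class J.
  exact: reprK.
exists (a * c), (b * d); rewrite !mulf_neq0 //; split=> //=.
have AC (A B C D : ideal R) : (A * B * (C * D))%g = ((A * C) * (B * D))%g.
  rewrite -!mulgA; congr (_ * _)%g; rewrite !mulgA.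
  by congr (_ * _)%g; apply: ideal_mulC.
by rewrite -!principalM AC E F AC.
Qed.

Fact class_mulC : commutative class_mul.
Proof.
apply: class_ind => I; apply: class_ind => J; rewrite !class_mulE.
by apply/ideal_classP; exists 1, 1; rewrite oner_neq0 /=; split=> //;
  congr (_ * _)%g; apply: ideal_mulC.
Qed.
Fact class_mulA : associative class_mul.
Proof.
apply: class_ind => I; apply: class_ind => J; apply: class_ind => L.
rewrite !class_mulE; apply/ideal_classP.
by exists 1, 1; rewrite oner_neq0 /= ideal_mulA.
Qed.
Fact class_mul1 : left_id class_one class_mul.
Proof.
apply: class_ind => I; rewrite class_mulE; apply/ideal_classP.
by exists 1, 1; rewrite oner_neq0 /= ideal_mul1.
Qed.
Fact class_mul1r : right_id class_one class_mul.
Proof. by move=> x; rewrite class_mulC class_mul1. Qed.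
Fact class_mulV : left_inverse class_one class_inv class_mul.
Proof.
apply: class_ind => I; rewrite class_mulC.
rewrite -{1}[ideal_class I]reprK class_mulE; apply/ideal_classP.
rewrite /cofactor; case: cid => /= L [a a0 E].
by exists 1, a; rewrite oner_neq0 E !principalM mul1r mulr1.
Qed.
Fact class_mulVr : right_inverse class_one class_inv class_mul.
Proof. by move=> x; rewrite class_mulC class_mulV. Qed.

HB.instance Definition _ := isGroup.Build class_group
  class_mulA class_mul1 class_mul1r class_mulV class_mulVr.

End ClassGroup.

Section UnitGroup.
Variable F : fieldType.

Definition nonzero := {x : F | x != 0}.
HB.instance Definition _ := Choice.on nonzero.

Fact nonzero_mul_subproof (x y : nonzero) : val x * val y != 0.
Proof. by rewrite mulf_neq0 // (valP x, valP y). Qed.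
Definition nonzero_mul (x y : nonzero) : nonzero :=
  exist (fun z : F => z != 0) _ (nonzero_mul_subproof x y).
Definition nonzero_one : nonzero := exist (fun z : F => z != 0) 1 (oner_neq0 F).
Fact nonzero_inv_subproof (x : nonzero) : (val x)^-1 != 0.
Proof. by rewrite invr_eq0 (valP x). Qed.
Definition nonzero_inv (x : nonzero) : nonzero :=
  exist (fun z : F => z != 0) _ (nonzero_inv_subproof x).

Fact nonzero_mulA : associative nonzero_mul.
Proof. by move=> x y z; apply: val_inj; rewrite /= mulrA. Qed.
Fact nonzero_mul1 : left_id nonzero_one nonzero_mul.
Proof. by move=> x; apply: val_inj; rewrite /= mul1r. Qed.
Fact nonzero_mul1r : right_id nonzero_one nonzero_mul.
Proof. by move=> x; apply: val_inj; rewrite /= mulr1. Qed.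
Fact nonzero_mulV : left_inverse nonzero_one nonzero_inv nonzero_mul.
Proof. by move=> x; apply: val_inj; rewrite /= mulVf // (valP x). Qed.
Fact nonzero_mulVr : right_inverse nonzero_one nonzero_inv nonzero_mul.
Proof. by move=> x; apply: val_inj; rewrite /= mulfV // (valP x). Qed.

HB.instance Definition _ := isGroup.Build nonzero
  nonzero_mulA nonzero_mul1 nonzero_mul1r nonzero_mulV nonzero_mulVr.

End UnitGroup.

(* The group homomorphisms G -> C^*, where C is R[i]; multiplicative maps
   between groups preserve 1. *)
Definition dual_group (R : realType) (G : groupType) : set (G -> nonzero R[i]) :=
  [set chi : G -> nonzero R[i] | {morph chi : x y / (x * y)%g}]%classic.
Arguments dual_group : clear implicits.

Section RingOfIntegers.
Variable K : fieldExtType rat.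

Definition integral_over_Z : {pred K} :=
  fun x => `[< integralOver (intr : int -> K) x >].

Fact integral_subring : subring_closed integral_over_Z.
Proof.
split=> [|x y /asboolP Ix /asboolP Iy|x y /asboolP Ix /asboolP Iy]; apply/asboolP.
- exact: integral1.
- exact: integral_sub.
- exact: integral_mul.
Qed.

Record ring_of_integers :=
  RingOfIntegers { roi_val :> K; roi_valP : roi_val \in integral_over_Z }.

HB.instance Definition _ := [isSub for roi_val].
HB.instance Definition _ := [Choice of ring_of_integers by <:].
HB.instance Definition _ :=
  GRing.SubChoice_isSubComNzRing.Build _ _ ring_of_integers integral_subring.

Definition roi_unit : {pred ring_of_integers} :=
  fun x => `[< exists y, y * x = 1 >].
Definition roi_inv (x : ring_of_integers) : ring_of_integers :=
  if pselect (exists y, y * x = 1) is left h then sval (cid h) else x.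

Fact roi_mulVx : {in roi_unit, left_inverse 1 roi_inv *%R}.
Proof. by move=> x /asboolP h; rewrite /roi_inv; case: pselect => // ?; case: cid. Qed.
Fact roi_unitPl x y : y * x = 1 -> roi_unit x.
Proof. by move=> h; apply/asboolP; exists y. Qed.
Fact roi_invr_out : {in [predC roi_unit], roi_inv =1 id}.
Proof. by move=> x /asboolP h; rewrite /roi_inv; case: pselect. Qed.

HB.instance Definition _ := GRing.ComNzRing_hasMulInverse.Build ring_of_integers
  roi_mulVx roi_unitPl roi_invr_out.

Fact roi_integral : GRing.integral_domain_axiom ring_of_integers.
Proof.
move=> x y /(congr1 val); rewrite rmorphM rmorph0 => /eqP.
by rewrite mulf_eq0 -!(inj_eq val_inj) rmorph0.
Qed.

HB.instance Definition _ :=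
  GRing.ComUnitRing_isIntegral.Build ring_of_integers roi_integral.

End RingOfIntegers.

Notation "'Cl(' K )" := (class_group (ring_of_integers K)) (format "'Cl(' K )").

(* fset_set A is the finite set A when A is finite, as is Cl(K). *)
Definition class_number (K : fieldExtType rat) : nat :=
  #|` fset_set [set: Cl(K)]%classic|.

(* Main.v *)
Require Import Defs.
From mathcomp Require Import all_boot all_order all_algebra all_field.
From mathcomp Require Import boolp classical_sets functions cardinality.
From mathcomp Require Import fsbigop reals finmap complex.
Import GRing.Theory.
Local Open Scope ring_scope.

(** Over a principal ideal ring every invertible ideal is [principal a] with [a != 0], hence
    equivalent to the unit ideal, so the class group is trivial ([pid_class_group_trivial]). Then
    [h] is 1 and the only character is the constant 1 ([dual_group_trivial]); the formula collapses
    to a product of sums of ones. *)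

Lemma inv_principal_neq0 (R : idomainType) (I : inv_ideal R) (a : R) :
  (I : ideal R) = principal a -> a != 0.
Proof.
move=> Ia; case: (inv_idealP I) => J [c [c0]]; rewrite Ia => E.
(* If [a] were 0, the product of [I] with its cofactor [J] would be the zero ideal, yet it contains
   [c]. *)
apply: contra_neq c0 => a0; rewrite a0 in E.
suff [b ->] : principal (0 : R) c by rewrite mulr0.
have : principal c c by exists 1; rewrite mul1r.
rewrite -E; apply: ideal_mul_sub => _ y [b ->] _.
by exists 0; rewrite !mulr0 mul0r.
Qed.

Lemma pid_class_group_trivial (R : idomainType) :
  principal_ideal_ring R -> forall x : class_group R, x = 1%g.
Proof.
move=> pid; apply: class_ind => I; apply/ideal_classP.
(* The witnesses express (1) I = (a) (1), comparing [I] with the unit ideal. *)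
have [a Ia] := pid I; exists 1, a; split; first exact: oner_neq0.
- exact: inv_principal_neq0 Ia.
- by rewrite Ia /= !principalM mul1r mulr1.
Qed.

Lemma dual_group_trivial (R : realType) (G : groupType) :
  (forall x : G, x = 1%g) -> dual_group R G = [set fun=> 1%g]%classic.
Proof.
move=> G1; apply/seteqP; split=> [chi chiM|_ ->] /=; last first.
  by move=> x y; rewrite mulg1.
(* Multiplicativity makes [chi 1] idempotent, so cancelling one factor gives [chi 1 = 1]. *)
apply/funext => x; rewrite (G1 x); apply: (mulgI (chi 1%g)).
by rewrite -chiM !mulg1.
Qed.

Theorem corollary2 (R : realType) (K : fieldExtType rat)
  (hPID : principal_ideal_ring (ring_of_integers K))
  (alpha : ring_of_integers K) (halpha : alpha != 0)
  (g : nat) (p : 'I_g -> inv_ideal (ring_of_integers K)) (e : 'I_g -> nat)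
  (hprime : forall i, prime_ideal (p i)) (hdistinct : injective p)
  (hpos : forall i, (0 < e i)%N)
  (hfact : principal alpha = (\prod_(i < g) (p i : ideal _) ^+ e i)%g) :
  let h := class_number K in
  let n : R[i] := h%:R^-1 *
    \sum_(chi \in dual_group R Cl(K))
      \prod_(i < g) \sum_(k < (e i).+1) val (chi (ideal_class (p i))) ^+ k in
  n = \prod_(i < g) (e i + 1)%:R.
Proof.
move=> h n; have Cl1 := pid_class_group_trivial _ hPID.
have h1 : h = 1%N.
  rewrite /h /class_number.
  have -> : [set: Cl(K)]%classic = [set 1%g]%classic.
    by apply/seteqP; split=> x //= _; apply: Cl1.
  by rewrite fset_set1 cardfs1.
rewrite /n h1 invr1 mul1r (dual_group_trivial _ _ Cl1) fsbig_set1.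
apply: eq_bigr => i _.
(* Each term is a power of 1, and k runs over the [(e i).+1] values from 0 to [e i]. *)
under eq_bigr do rewrite expr1n.
by rewrite sumr_const card_ord addn1.
Qed.
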